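(* Let $Y\subseteq\ell_1^n$ be a linear subspace of the complex $\ell_1^n$ space given as $Y=\ker f=\{z\in\mathbb{C}^n:\ \sum_{j=1}^nf_jz_j=0\}$ for some non-zero vector $f=(f_1,\dots,f_n)\in\mathbb{C}^n$. If a minimal projection from $\ell_1^n$ onto $Y$ is unique, then it is $2$-strongly unique.
   Context: The complex space $\ell_1^n$ is $\mathbb{C}^n$ with norm $\|x\|_1=|x_1|+\dots+|x_n|$; $n\ge2$. For a linear subspace $Y$ of a finite-dimensional normed space $X$, a projection $P:X\to Y$ is a linear map with $P(y)=y$ for all $y\in Y$; $\|P\|$ is the operator norm. The relative projection constant is $\lambda(Y,X)=\inf\|P\|$ over all linear projections $P:X\to Y$, and $P$ is a minimal projection if $\|P\|=\lambda(Y,X)$. For a real $\alpha\ge1$, a projection $P:X\to Y$ is an $\alpha$-strongly unique minimal projection if there is $r>0$ such that $\|Q\|^\alpha\ge\|P\|^\alpha+r\|Q-P\|^\alpha$ for every linear projection $Q:X\to Y$. *)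

(* Defs.v *)
From HB Require Import structures.
From mathcomp Require Import all_boot all_order all_algebra.
From mathcomp Require Import complex.
From mathcomp Require Import boolp classical_sets reals exp.

Set Implicit Arguments.
Unset Strict Implicit.
Unset Printing Implicit Defensive.
Import Order.TTheory GRing.Theory Num.Theory.
Import ComplexField.Normc.
Local Open Scope ring_scope.
Local Open Scope complex_scope.
Local Open Scope classical_set_scope.

(* The norm of l_1^n, with real values ([normc] is the real-valued modulus on
   R[i], whereas `|_| on R[i] takes its values in R[i]). *)
Definition l1norm (R : realType) (n : nat) (x : 'rV[R[i]]_n) : R :=
  \sum_(j < n) normc (x 0 j).

(* In this section N is meant to be a norm on the finite-dimensional complex
   space X.  Linear maps X -> Y are represented as endomorphisms of X whose
   values lie in Y. *)
Section Projections.
Variables (R : realType) (X : vectType R[i]) (N : X -> R).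
Implicit Types (Y : {vspace X}) (P Q : 'End(X)).

(* [sup] is a true supremum when N is a norm: 0 is in the unit ball, and linear
   maps are bounded since X is finite-dimensional. *)
Definition opnorm P : R := sup [set N (P x) | x in [set x | N x <= 1]].

Definition is_projection Y P : Prop :=
  (forall x, P x \in Y) /\ (forall y, y \in Y -> P y = y).

(* A true infimum when N is a norm: every subspace Y is the range of some
   projection, and operator norms are nonnegative. *)
Definition proj_const Y : R := inf [set opnorm P | P in is_projection Y].

Definition minimal_projection Y P : Prop :=
  is_projection Y P /\ opnorm P = proj_const Y.

Definition unique_minimal_projection Y P : Prop :=
  minimal_projection Y P /\ forall Q, minimal_projection Y Q -> Q = P.

Definition strongly_unique_minimal_projection (alpha : R) Y P : Prop :=
  is_projection Y P /\
  exists2 r : R, 0 < r & forall Q, is_projection Y Q ->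
    opnorm P `^ alpha + r * opnorm (Q - P) `^ alpha <= opnorm Q `^ alpha.

End Projections.

(* Main.v *)
Require Import Defs.
From mathcomp Require Import all_boot all_order all_algebra.
From mathcomp Require Import complex.
From mathcomp Require Import boolp classical_sets reals exp.
From mathcomp Require Import topology normedtype derive lra ring.
Import Order.TTheory GRing.Theory Num.Theory.
Import numFieldTopology.Exports numFieldNormedType.Exports.
Local Open Scope ring_scope.
Local Open Scope complex_scope.

(** Projections onto ker f have the form z |-> z - f(z) y with f(y) = 1, and the
    l_1 operator norm is the largest norm of a column.  Rotating the coordinates
    of y by the phases of f replaces f by its moduli w, so that y becomes
    x + i t with w.x = 1 and w.t = 0.  Dropping t does not increase any column
    norm, hence the unique minimal projection is real.  On the real affine space
    w.x = 1 the column norms are piecewise linear, and a unique minimizer x0 of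
    their maximum is sharp: some column with w_j <> 0 has norm at least
    M + r |x - x0|, by compactness of the sphere of directions.  Minkowski's
    inequality in the plane bounds the square of the complex column norm below
    by the square of the real one plus (w_j |t|)^2, which gives the quadratic
    growth in the imaginary directions. *)

(** * One-sided derivatives of the real column norms *)

Section RealColumns.
Local Open Scope classical_set_scope.

(** The one-sided derivative of the absolute value at [a] in direction [b]. *)
Definition dabs {R : realType} (a b : R) : R :=
  if a == 0 then `|b| else Num.sg a * b.

(** Convexity: for [a != 0] the left side equals [Num.sg a * (a + b)], a supporting line of the
    absolute value. *)
Lemma dabs_le (R : realType) (a b : R) : `|a| + dabs a b <= `|a + b|.
Proof.
rewrite /dabs; have [->|a0] := eqVneq a 0; first by rewrite normr0 !add0r.
rewrite normrEsg -mulrDr; apply: le_trans (ler_norm _) _.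
by rewrite normrM normr_sg a0 mul1r.
Qed.

Lemma dabsZ (R : realType) (c a b : R) :
  0 <= c -> dabs a (c * b) = c * dabs a b.
Proof.
move=> c0; rewrite /dabs; case: eqP => _; last by rewrite mulrCA.
by rewrite normrM ger0_norm.
Qed.

(** The convexity bound is attained as long as [a + t * b] has not crossed zero. *)
Lemma dabs_near (R : realType) (a b : R) :
  \forall t \near 0^'+, `|a + t * b| = `|a| + t * dabs a b.
Proof.
have [->|a0] := eqVneq a 0.
  near=> t; rewrite -dabsZ; last by near: t; exact: nbhs_right_ge.
  by rewrite /dabs eqxx normr0 !add0r.
near=> t.
have t0 : 0 <= t by near: t; exact: nbhs_right_ge.
(* The added 1 keeps the denominator positive when [b = 0]. *)
have tle : t <= `|a| / (`|b| + 1).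
  by near: t; apply: nbhs_right_le; rewrite divr_gt0 ?normr_gt0 ?ltr_wpDl.
have tb : `|t * b| <= `|a|.
  rewrite normrM (ger0_norm t0); apply: (@le_trans _ _ (t * (`|b| + 1))).
    by rewrite ler_wpM2l// lerDl.
  by rewrite -ler_pdivlMr// ltr_wpDl.
rewrite /dabs (negbTE a0); move/lt_total/orP: (a0) => [an|ap].
- rewrite (ltr0_sg an); move: tb; rewrite (ltr0_norm an) => tb.
  rewrite ler0_norm; first by lra.
  by have := ler_norm (t * b); lra.
- rewrite (gtr0_sg ap); move: tb; rewrite (gtr0_norm ap) => tb.
  rewrite ger0_norm; first by lra.
  by have := ler_norm (- (t * b)); rewrite normrN; lra.
Unshelve. all: by end_near. Qed.

Lemma continuous_dabs (R : realType) (a : R) : continuous (dabs a).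
Proof.
rewrite /dabs; case: eqP => _ b; first exact: norm_continuous.
exact: mulrl_continuous.
Qed.

(** The norm of the [j]-th column of the matrix of z |-> z - (w.z) x. *)
Definition colnorm {R : realType} {n : nat} (w x : 'rV[R]_n) (j : 'I_n) : R :=
  \sum_k `|(k == j)%:R - w 0 j * x 0 k|.

(** The one-sided derivative of [colnorm w _ j] at [x] in direction [d]. *)
Definition dcolnorm {R : realType} {n : nat} (w x d : 'rV[R]_n) (j : 'I_n) : R :=
  \sum_k dabs ((k == j)%:R - w 0 j * x 0 k) (- w 0 j * d 0 k).

Definition norm1 {R : realType} {n : nat} (d : 'rV[R]_n) : R :=
  \sum_k `|d 0 k|.

Lemma colnorm_ge (R : realType) (n : nat) (w x d : 'rV[R]_n) (j : 'I_n) :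
  colnorm w x j + dcolnorm w x d j <= colnorm w (x + d) j.
Proof.
rewrite -big_split/=; apply: ler_sum => k _.
apply: le_trans (dabs_le _ _ _) _.
by rewrite !mxE mulrDr opprD addrA mulNr.
Qed.

Lemma colnorm_near (R : realType) (n : nat) (w x d : 'rV[R]_n) (j : 'I_n) :
  \forall t \near 0^'+,
    colnorm w (x + t *: d) j = colnorm w x j + t * dcolnorm w x d j.
Proof.
near=> t; rewrite mulr_sumr -big_split/=.
have tP : forall k, `|(k == j)%:R - w 0 j * x 0 k + t * (- w 0 j * d 0 k)| =
    `|(k == j)%:R - w 0 j * x 0 k| +
    t * dabs ((k == j)%:R - w 0 j * x 0 k) (- w 0 j * d 0 k).
  by near: t; apply: filter_forall => k; exact: dabs_near.
apply: eq_bigr => k _; rewrite -tP !mxE; congr (`| _ |).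
by rewrite mulrDr opprD addrA mulNr mulrN mulrCA.
Unshelve. all: by end_near. Qed.

Lemma dcolnormZ (R : realType) (n : nat) (w x d : 'rV[R]_n) (j : 'I_n) (c : R) :
  0 <= c -> dcolnorm w x (c *: d) j = c * dcolnorm w x d j.
Proof.
move=> c0; rewrite mulr_sumr; apply: eq_bigr => k _.
by rewrite -dabsZ// mxE mulrCA.
Qed.

(** * Compactness of the sphere of directions and sharpness *)

Lemma continuous_dcolnorm (R : realType) (n : nat) (w x : 'rV[R]_n) (j : 'I_n) :
  continuous (fun d => dcolnorm w x d j).
Proof.
apply: (continuous_big (op := +%R)) => [|k _ d]; first exact: add_continuous.
apply: (@continuous_comp _ _ _ (fun d : 'rV[R]_n => - w 0 j * d 0 k)).
  apply: (@continuous_comp _ _ _ (fun d : 'rV[R]_n => d 0 k)).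
    exact: coord_continuous.
  exact: mulrl_continuous.
exact: continuous_dabs.
Qed.

Lemma continuous_norm1 (R : realType) (n : nat) : continuous (@norm1 R n).
Proof.
apply: (continuous_big (op := +%R)) => [|k _ d]; first exact: add_continuous.
apply: (@continuous_comp _ _ _ (fun d : 'rV[R]_n => d 0 k)).
  exact: coord_continuous.
exact: norm_continuous.
Qed.

Lemma continuous_dot (R : realType) (n : nat) (w : 'rV[R]_n) :
  continuous (fun d : 'rV[R]_n => \sum_k w 0 k * d 0 k).
Proof.
apply: (continuous_big (op := +%R)) => [|k _ d]; first exact: add_continuous.
apply: (@continuous_comp _ _ _ (fun d : 'rV[R]_n => d 0 k)).
  exact: coord_continuous.
exact: mulrl_continuous.
Qed.

Lemma compact_norm1_sphere (R : realType) (n : nat) (w : 'rV[R]_n) :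
  compact [set d : 'rV[R]_n | norm1 d = 1 /\ \sum_k w 0 k * d 0 k = 0].
Proof.
apply: (subclosed_compact _ (rV_compact (fun=> @segment_compact R (-1) 1))).
- apply: closedI.
    apply: (closed_comp (f := @norm1 R n) (D := [set 1])).
      by move=> d _; exact: continuous_norm1.
    exact: closed_eq.
  apply: (closed_comp (f := fun d : 'rV[R]_n => \sum_k w 0 k * d 0 k) (D := [set 0])).
    by move=> d _; exact: continuous_dot.
  exact: closed_eq.
- move=> d [d1 _] k; rewrite /= in_itv/= -ler_norml -d1 /norm1.
  by rewrite (bigD1 k)//= lerDl sumr_ge0.
Qed.

Lemma norm1_eq0 (R : realType) (n : nat) (d : 'rV[R]_n) :
  (norm1 d == 0) = (d == 0).
Proof.
apply/eqP/eqP => [/eqP|->]; last first.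
  by rewrite /norm1 big1// => k _; rewrite mxE normr0.
rewrite psumr_eq0// => /allP d0; apply/rowP => k; rewrite mxE.
by apply/normr0_eq0/eqP/d0; rewrite mem_index_enum.
Qed.

Lemma norm1Z (R : realType) (n : nat) (c : R) (d : 'rV[R]_n) :
  norm1 (c *: d) = `|c| * norm1 d.
Proof. by rewrite mulr_sumr; apply: eq_bigr => k _; rewrite mxE normrM. Qed.

(** A single linear equation in at least two unknowns has a nonzero solution; this makes the sphere
    of directions nonempty. *)
Lemma exists_orthogonal (R : realType) (n : nat) (w : 'rV[R]_n) :
  (2 <= n)%N -> exists2 d : 'rV[R]_n, \sum_k w 0 k * d 0 k = 0 & d != 0.
Proof.
move=> n2; have: kermx w^T != 0.
  rewrite -mxrank_eq0 mxrank_ker subn_eq0 -ltnNge.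
  exact: leq_ltn_trans (rank_leq_col _) n2.
move=> /rowV0Pn[d /sub_kermxP dw d0]; exists d => //.
transitivity ((d *m w^T) 0 0); last by rewrite dw mxE.
by rewrite mxE; apply: eq_bigr => k _; rewrite mxE mulrC.
Qed.

(** By uniqueness, each admissible direction has positive slope in some active column. The largest
    active slope is continuous in the direction, so it has a positive minimum [r] on the sphere, and
    [colnorm_ge] turns slopes into global bounds. *)
Lemma colnorm_sharp (R : realType) (n : nat) (w x0 : 'rV[R]_n) (M : R) :
  (2 <= n)%N ->
  \sum_k w 0 k * x0 0 k = 1 ->
  (forall j, colnorm w x0 j <= M) ->
  (forall x : 'rV[R]_n, \sum_k w 0 k * x 0 k = 1 -> (forall j, colnorm w x j <= M) ->
    x = x0) ->
  exists2 r : R, 0 < r & forall x : 'rV[R]_n, \sum_k w 0 k * x 0 k = 1 ->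
    exists2 j, w 0 j != 0 & M + r * norm1 (x - x0) <= colnorm w x j.
Proof.
move=> n2 wx0 x0M x0uniq.
(* Requiring [w 0 j != 0] ensures that the column found also grows in imaginary directions. *)
pose A (j : 'I_n) := (w 0 j != 0) && (colnorm w x0 j == M).
have Apos (d : 'rV[R]_n) : \sum_k w 0 k * d 0 k = 0 -> d != 0 ->
    exists2 j, A j & 0 < dcolnorm w x0 d j.
  move=> wd d0; apply: contrapT => noA.
  (* A nonpositive slope in all the active columns would let x0 + t d compete
     with x0 for small t > 0; columns with w_j = 0 are constant. *)
  have [t [t0 tM]] : exists t : R, 0 < t /\
      forall j, colnorm w (x0 + t *: d) j <= M.
    apply: (@filter_ex _ (0 : R)^'+).
    near=> t; split; first by near: t; exact: nbhs_right_gt.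
    near: t; apply: filter_forall => j.
    have [wj|wj] := eqVneq (w 0 j) 0.
      near=> t; apply: le_trans (x0M j); rewrite le_eqVlt; apply/orP; left.
      by apply/eqP/eq_bigr => k _; rewrite wj !mul0r.
    have [cj|cj] := eqVneq (colnorm w x0 j) M.
      near=> t.
      have -> : colnorm w (x0 + t *: d) j =
          colnorm w x0 j + t * dcolnorm w x0 d j.
        by near: t; exact: colnorm_near.
      rewrite cj gerDl pmulr_rle0; last by near: t; exact: nbhs_right_gt.
      by rewrite leNgt; apply/negP => ?; apply: noA; exists j; rewrite /A ?wj ?cj ?eqxx.
    have {}cj : colnorm w x0 j < M by rewrite lt_neqAle cj x0M.
    have e0 : 0 < (M - colnorm w x0 j) / (`|dcolnorm w x0 d j| + 1).
      by rewrite divr_gt0 ?subr_gt0 ?ltr_wpDl.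
    near=> t.
    have -> : colnorm w (x0 + t *: d) j =
        colnorm w x0 j + t * dcolnorm w x0 d j.
      by near: t; exact: colnorm_near.
    have t0 : 0 <= t by near: t; exact: nbhs_right_ge.
    rewrite addrC -lerBrDr; apply: (@le_trans _ _ (t * (`|dcolnorm w x0 d j| + 1))).
      by rewrite ler_wpM2l// (le_trans (ler_norm _))// lerDl.
    rewrite -ler_pdivlMr ?ltr_wpDl//.
    by near: t; exact: nbhs_right_le.
  (* The competitor is admissible, so it coincides with [x0], against [0 < t] and [d != 0]. *)
  have /eqP : t *: d = 0.
    apply: (addrI x0); rewrite addr0; apply: x0uniq tM.
    transitivity (\sum_k w 0 k * x0 0 k + t * (\sum_k w 0 k * d 0 k)).
      rewrite mulr_sumr -big_split/=.
      by apply: eq_bigr => k _; rewrite !mxE mulrDr mulrCA.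
    by rewrite wd wx0 mulr0 addr0.
  by rewrite scaler_eq0 (negbTE d0) gt_eqF.
pose K := [set d : 'rV[R]_n | norm1 d = 1 /\ \sum_k w 0 k * d 0 k = 0].
pose G (d : 'rV[R]_n) := \big[Num.max/0]_(j | A j) dcolnorm w x0 d j.
have normalize (d : 'rV[R]_n) : \sum_k w 0 k * d 0 k = 0 -> d != 0 ->
    K ((norm1 d)^-1 *: d).
  move=> wd d0; have nd0 : norm1 d != 0 by rewrite norm1_eq0.
  split; first by rewrite norm1Z normfV (ger0_norm (sumr_ge0 _ _))// mulVf.
  transitivity ((norm1 d)^-1 * (\sum_k w 0 k * d 0 k)).
    by rewrite mulr_sumr; apply: eq_bigr => k _; rewrite mxE mulrCA.
  by rewrite wd mulr0.
have [d1 wd1 d10] := exists_orthogonal _ _ w n2.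
have [c cK Gmin] : exists2 c, c \in K & forall d, d \in K -> G c <= G d.
  apply: EVT_min_rV.
  - by exists ((norm1 d1)^-1 *: d1); exact: normalize.
  - exact: compact_norm1_sphere.
  - apply: continuous_subspaceT.
    apply: (continuous_big (op := Num.max)) => [|j _]; first exact: max_continuous.
    exact: continuous_dcolnorm.
have Gc : 0 < G c.
  move: cK; rewrite inE => -[c1 wc].
  have [|j Aj jpos] := Apos c wc; first by rewrite -norm1_eq0 c1 oner_eq0.
  apply: lt_le_trans jpos _; exact: le_bigmax_cond.
exists (G c) => // x wx.
have wxx0 : \sum_k w 0 k * (x - x0) 0 k = 0.
  transitivity (\sum_k w 0 k * x 0 k - \sum_k w 0 k * x0 0 k).
    by rewrite -sumrB; apply: eq_bigr => k _; rewrite !mxE mulrBr.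
  by rewrite wx wx0 subrr.
(* There is no direction to normalize when [x = x0]; any active column will do, and [d1] provides
   one. *)
have [xx0|xx0] := eqVneq (x - x0) 0.
  have [j /andP[wj /eqP cj] _] := Apos d1 wd1 d10.
  exists j => //; have /eqP -> : norm1 (x - x0) == 0 by rewrite norm1_eq0 xx0.
  by rewrite mulr0 addr0 -cj; move/subr0_eq: xx0 => ->.
have n0 : 0 < norm1 (x - x0) by rewrite lt_neqAle eq_sym norm1_eq0 xx0 sumr_ge0.
(* A maximum at least [G c] is either its default 0, excluded by [Gc], or reached by an active
   column. *)
have /mem_set/Gmin/bigmax_geP[|[j /andP[wj /eqP cj] Lj]] := normalize _ wxx0 xx0.
  by rewrite leNgt Gc.
exists j => //; rewrite -[in leRHS](subrK x0 x) addrC.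
rewrite [x - x0 + x0]addrC; apply: le_trans (colnorm_ge _ _ _ _ _ _).
rewrite addrC cj lerD2l; move: Lj; rewrite dcolnormZ ?invr_ge0 ?(ltW n0)//.
by rewrite mulrC ler_pdivlMr.
Unshelve. all: by end_near. Qed.
End RealColumns.

(** * The complex modulus and Minkowski's inequality *)

Section ComplexColumns.
Import ComplexField.Normc.

Lemma normc_ge0 (R : rcfType) (z : R[i]) : 0 <= normc z.
Proof. by case: z => a b; exact: sqrtr_ge0. Qed.

Lemma normc_sum (R : rcfType) (I : finType) (z : I -> R[i]) :
  normc (\sum_k z k) <= \sum_k normc (z k).
Proof.
apply: (big_ind2 (fun x y => normc x <= y)) => //; first by rewrite normc0.
by move=> x1 y1 x2 y2 h1 h2; apply: le_trans (le_normcD _ _) (lerD h1 h2).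
Qed.

Lemma normc_complex0 (R : rcfType) (a : R) : normc a%:C = `|a|.
Proof. by rewrite /= expr0n/= addr0 sqrtr_sqr. Qed.

Lemma sqr_normc_complex (R : rcfType) (a b : R) :
  normc (a +i* b) ^+ 2 = a ^+ 2 + b ^+ 2.
Proof. by rewrite sqr_sqrtr// addr_ge0 ?sqr_ge0. Qed.

Lemma normc_complex_le (R : rcfType) (a b : R) :
  normc (a +i* b) <= `|a| + `|b|.
Proof.
rewrite -ler_sqr ?nnegrE ?addr_ge0 ?normc_ge0// sqr_normc_complex.
rewrite sqrrD !real_normK ?num_real//.
by rewrite addrAC lerDl mulrn_wge0 ?mulr_ge0.
Qed.

(** The triangle inequality for the complex numbers [|a k| + i |b k|], which have the same moduli as
    [a k +i* b k]. *)
Lemma minkowski_complex (R : rcfType) (I : finType) (a b : I -> R) :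
  (\sum_k `|a k|) ^+ 2 + (\sum_k `|b k|) ^+ 2 <=
  (\sum_k normc (a k +i* b k)) ^+ 2.
Proof.
rewrite -sqr_normc_complex ler_sqr ?nnegrE ?normc_ge0 ?sumr_ge0//; last first.
  by move=> k _; exact: normc_ge0.
have -> : (\sum_k `|a k|) +i* (\sum_k `|b k|) = \sum_k (`|a k| +i* `|b k|).
  by apply: (big_ind3 (fun x y z => x +i* y = z)) => // ? ? ? ? ? ? <- <-.
apply: le_trans (normc_sum _ _ _) _; apply: ler_sum => k _.
by rewrite -ler_sqr ?nnegrE ?normc_ge0// !sqr_normc_complex !real_normK ?num_real.
Qed.

Lemma l1norm_ge0 (R : realType) (n : nat) (x : 'rV[R[i]]_n) : 0 <= l1norm x.
Proof. by apply: sumr_ge0 => k _; exact: normc_ge0. Qed.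

Lemma l1norm_delta (R : realType) (n : nat) (j : 'I_n) :
  l1norm (delta_mx 0 j : 'rV[R[i]]_n) = 1.
Proof.
rewrite /l1norm (bigD1 j)//= big1 ?addr0 => [|k kj]; last first.
  by rewrite mxE eqxx (negbTE kj) normc0.
by rewrite mxE !eqxx normc1.
Qed.

Lemma l1normZ (R : realType) (n : nat) (c : R[i]) (x : 'rV[R[i]]_n) :
  l1norm (c *: x) = normc c * l1norm x.
Proof. by rewrite mulr_sumr; apply: eq_bigr => k _; rewrite mxE normcM. Qed.

(** * The operator norm as the largest column norm *)

Section OpNorm.
Context {R : realType} {n : nat}.
Implicit Types (P : 'End('rV[R[i]]_n)) (B : R).

Lemma l1norm_image_le P B (x : 'rV[R[i]]_n) :
  (forall j, l1norm (P (delta_mx 0 j)) <= B) -> l1norm (P x) <= l1norm x * B.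
Proof.
move=> PB; rewrite [in leLHS](row_sum_delta x) linear_sum mulr_suml.
apply: (@le_trans _ _ (\sum_k l1norm (P (x 0 k *: delta_mx 0 k)))).
  rewrite /l1norm exchange_big/=; apply: ler_sum => i _.
  by rewrite summxE; exact: normc_sum.
apply: ler_sum => k _; rewrite linearZ l1normZ.
by rewrite ler_wpM2l ?normc_ge0 ?PB.
Qed.

Lemma opnorm_l1_le P B : 0 <= B ->
  (forall j, l1norm (P (delta_mx 0 j)) <= B) -> opnorm (@l1norm R n) P <= B.
Proof.
move=> B0 PB; apply: ge_sup.
  exists (l1norm (P 0)); exists 0 => //=.
  by rewrite /l1norm big1// => k _; rewrite mxE normc0.
move=> _ [x /= x1 <-]; apply: le_trans (l1norm_image_le _ _ x PB) _.
by rewrite -[leRHS]mul1r ler_wpM2r.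
Qed.

Lemma opnorm_l1_ge P (j : 'I_n) :
  l1norm (P (delta_mx 0 j)) <= opnorm (@l1norm R n) P.
Proof.
apply: ub_le_sup; last by exists (delta_mx 0 j) => //=; rewrite l1norm_delta.
pose B := \sum_k l1norm (P (delta_mx 0 k)).
have B0 : 0 <= B by apply: sumr_ge0 => k _; exact: l1norm_ge0.
exists B => _ [x /= x1 <-].
apply: (@le_trans _ _ (l1norm x * B)); last first.
  by rewrite -[leRHS]mul1r ler_wpM2r.
apply: l1norm_image_le => k; rewrite /B (bigD1 k)//= lerDl.
by apply: sumr_ge0 => i _; exact: l1norm_ge0.
Qed.

Lemma opnorm_l1_ge0 P : (0 < n)%N -> 0 <= opnorm (@l1norm R n) P.
Proof.
by move=> n0; apply: le_trans (opnorm_l1_ge P (Ordinal n0)); exact: l1norm_ge0.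
Qed.

End OpNorm.

(** * Projections onto the kernel and rotation by phases *)

Section HyperplaneProjections.
Context {R : realType} {n : nat} (f : 'rV[R[i]]_n).
Implicit Types (y z : 'rV[R[i]]_n) (Y : {vspace 'rV[R[i]]_n}).

Definition hyperproj y : 'End('rV[R[i]]_n) :=
  linfun (mulmxr (1%:M - f^T *m y)).

Lemma hyperprojE y z : hyperproj y z = z - (\sum_j f 0 j * z 0 j) *: y.
Proof.
rewrite lfunE/= mulmxBr mulmx1 mulmxA; congr (_ - _).
rewrite [z *m f^T]mx11_scalar mul_scalar_mx; congr (_ *: _).
by rewrite mxE; apply: eq_bigr => k _; rewrite mxE mulrC.
Qed.

Lemma hyperproj_delta y j : hyperproj y (delta_mx 0 j) = delta_mx 0 j - f 0 j *: y.
Proof.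
rewrite hyperprojE (bigD1 j)//= big1 ?addr0 => [|k kj].
  by rewrite mxE !eqxx mulr1.
by rewrite mxE eqxx (negbTE kj) mulr0.
Qed.

Lemma hyperproj_inj : f != 0 -> injective hyperproj.
Proof.
move=> /rV0Pn[j fj] y y' yy'.
have := hyperproj_delta y j; rewrite yy' hyperproj_delta.
by move/addrI/oppr_inj/(scalerI fj).
Qed.

Lemma hyperproj_projection Y y :
  (forall z, (z \in Y) = (\sum_j f 0 j * z 0 j == 0)) ->
  \sum_j f 0 j * y 0 j = 1 -> is_projection Y (hyperproj y).
Proof.
move=> hY fy; split=> [z|z]; rewrite hyperprojE ?hY; last first.
  by move/eqP->; rewrite scale0r subr0.
set a := \sum_j f 0 j * z 0 j.
apply/eqP; transitivity (a - a * \sum_j f 0 j * y 0 j).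
  rewrite mulr_sumr -sumrB; apply: eq_bigr => k _.
  by rewrite !mxE mulrBr mulrCA.
by rewrite fy mulr1 subrr.
Qed.

(** If f(e) = 1, then z - f(z) e lies in [Y] and is fixed by [Q]; solving for Q z gives y = e - Q
    e. *)
Lemma projection_hyperproj Y (Q : 'End('rV[R[i]]_n)) : f != 0 ->
  (forall z, (z \in Y) = (\sum_j f 0 j * z 0 j == 0)) ->
  is_projection Y Q ->
  exists2 y : 'rV[R[i]]_n, \sum_j f 0 j * y 0 j = 1 & Q = hyperproj y.
Proof.
move=> /rV0Pn[j fj] hY [QY Qid].
pose e : 'rV[R[i]]_n := (f 0 j)^-1 *: delta_mx 0 j.
have fe : \sum_k f 0 k * e 0 k = 1.
  rewrite (bigD1 j)//= big1 ?addr0 => [|k kj].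
    by rewrite !mxE !eqxx mulr1 mulfV.
  by rewrite !mxE eqxx (negbTE kj) !mulr0.
exists (e - Q e).
  transitivity (\sum_k f 0 k * e 0 k - \sum_k f 0 k * Q e 0 k).
    by rewrite -sumrB; apply: eq_bigr => k _; rewrite !mxE mulrBr.
  by have := QY e; rewrite hY => /eqP ->; rewrite fe subr0.
apply/lfunP => z; rewrite hyperprojE.
set a := \sum_k _.
have /Qid : z - a *: e \in Y.
  rewrite hY; apply/eqP; transitivity (a - a * \sum_k f 0 k * e 0 k).
    rewrite mulr_sumr -sumrB; apply: eq_bigr => k _.
    by rewrite !mxE mulrBr mulrCA.
  by rewrite fe mulr1 subrr.
rewrite linearB linearZ/= => /eqP; rewrite subr_eq => /eqP ->.
by rewrite scalerBr opprB addrA addrAC.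
Qed.

Definition modulus : 'rV[R]_n := \row_k normc (f 0 k).

(** The value 1 at zero coordinates keeps every phase unimodular, hence invertible. *)
Definition phase (k : 'I_n) : R[i] :=
  if f 0 k == 0 then 1 else (normc (f 0 k))%:C / f 0 k.

Lemma mul_phase k : f 0 k * phase k = (modulus 0 k)%:C.
Proof.
rewrite /phase mxE; have [->|fk] := eqVneq (f 0 k) 0; first by rewrite mul0r normc0.
by rewrite mulrC divfK.
Qed.

Lemma normc_phase k : normc (phase k) = 1.
Proof.
rewrite /phase; have [_|fk] := eqVneq (f 0 k) 0; first exact: normc1.
rewrite normcM normcV normc_complex0 ger0_norm ?normc_ge0// divff//.
by apply: contra_neq fk => /eq0_normc.
Qed.

Lemma phase_neq0 k : phase k != 0.
Proof.
by apply/eqP => p0; have /eqP := normc_phase k; rewrite p0 normc0 eq_sym oner_eq0.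
Qed.

Definition twist (x t : 'rV[R]_n) : 'rV[R[i]]_n :=
  \row_k (phase k * (x 0 k +i* t 0 k)).

Lemma twist_surj y : exists x t, y = twist x t.
Proof.
exists (\row_k complex.Re (y 0 k / phase k)).
exists (\row_k complex.Im (y 0 k / phase k)).
apply/rowP => k; rewrite !mxE; move: (phase_neq0 k); set p := phase k => p0.
have -> : complex.Re (y 0 k / p) +i* complex.Im (y 0 k / p) = y 0 k / p.
  by case: (y 0 k / p).
by rewrite mulrC divfK.
Qed.

Lemma twist_inj (x t x' t' : 'rV[R]_n) :
  twist x t = twist x' t' -> x = x' /\ t = t'.
Proof.
move=> /rowP xt; split; apply/rowP => k; have := xt k; rewrite !mxE;
  by move/(mulfI (phase_neq0 k)) => [].
Qed.

Lemma dot_twist (x t : 'rV[R]_n) :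
  \sum_k f 0 k * twist x t 0 k =
  (\sum_k modulus 0 k * x 0 k) +i* (\sum_k modulus 0 k * t 0 k).
Proof.
apply/esym; apply: (big_ind3 (fun (a b : R) (z : R[i]) => a +i* b = z)) => //.
  by move=> ? ? ? ? ? ? <- <-.
move=> k _; rewrite [twist _ _ _ _]mxE mulrA mul_phase.
by rewrite /GRing.mul/= !mul0r subr0 addr0.
Qed.

(** The analogue of [colnorm] for the vector x + i t. *)
Definition ccolnorm (x t : 'rV[R]_n) (j : 'I_n) : R :=
  \sum_k normc (((k == j)%:R - modulus 0 j * x 0 k) +i* (- modulus 0 j * t 0 k)).

(** Multiplying entry [k] by the unimodular [phase j / phase k] fixes the diagonal 1 and replaces
    [f 0 j * phase k] by [f 0 j * phase j], the modulus. *)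
Lemma l1norm_hyperproj_twist (x t : 'rV[R]_n) j :
  l1norm (hyperproj (twist x t) (delta_mx 0 j)) = ccolnorm x t j.
Proof.
rewrite hyperproj_delta; apply: eq_bigr => k _.
have -> : (delta_mx 0 j - f 0 j *: twist x t) 0 k =
    (k == j)%:R - f 0 j * (phase k * (x 0 k +i* t 0 k)) by rewrite !mxE eqxx.
have rot (z : R[i]) : normc z = normc (phase j / phase k * z).
  by rewrite normcM normcM normcV !normc_phase invr1 !mul1r.
rewrite rot; congr normc.
transitivity ((k == j)%:R - (modulus 0 j)%:C * (x 0 k +i* t 0 k)); last first.
  rewrite -[in LHS](rmorph_nat (real_complex R)).
  apply/eqP; rewrite eq_complex /= !mul0r; apply/andP; split; apply/eqP.
    by rewrite subr0.
  by rewrite addr0 sub0r mulNr.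
rewrite -mul_phase mulrBr; congr (_ - _).
  have [->|] := eqVneq k j; last by rewrite mulr0.
  by rewrite mulr1 mulfV// phase_neq0.
have := phase_neq0 k.
move: (phase k) (phase j) (x 0 k +i* t 0 k) => p q v p0.
by rewrite mulrA mulrCA; field.
Qed.

Lemma ccolnorm_real (x : 'rV[R]_n) j : ccolnorm x 0 j = colnorm modulus x j.
Proof.
by apply: eq_bigr => k _; rewrite [(0 : 'rV_n) _ _]mxE mulr0 normc_complex0.
Qed.

Lemma ccolnorm_sqr (x t : 'rV[R]_n) j :
  colnorm modulus x j ^+ 2 + (modulus 0 j * norm1 t) ^+ 2 <= ccolnorm x t j ^+ 2.
Proof.
apply: le_trans (minkowski_complex _ _ _ _); rewrite lerD2l le_eqVlt.
apply/orP; left; apply/eqP; congr (_ ^+ 2); rewrite mulr_sumr.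
have w0 : 0 <= modulus 0 j by rewrite mxE normc_ge0.
by apply: eq_bigr => k _; rewrite normrM normrN (ger0_norm w0).
Qed.

Lemma ccolnorm_ge (x t : 'rV[R]_n) j : colnorm modulus x j <= ccolnorm x t j.
Proof.
rewrite -ler_sqr ?nnegrE ?sumr_ge0//; last by move=> k _; exact: normc_ge0.
by apply: le_trans (ccolnorm_sqr _ _ _); rewrite lerDl sqr_ge0.
Qed.

(** Column [j] of the difference is [f 0 j] times a difference of twisted vectors, and
    [normc (f 0 j)] is at most [l1norm f]. *)
Lemma opnorm_hyperprojB (x t x' t' : 'rV[R]_n) :
  opnorm (@l1norm R n) (hyperproj (twist x t) - hyperproj (twist x' t')) <=
  l1norm f * (norm1 (x - x') + norm1 (t - t')).
Proof.
have ge0 (d : 'rV[R]_n) : 0 <= norm1 d by exact: sumr_ge0.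
apply: opnorm_l1_le => [|j]; first by rewrite mulr_ge0 ?l1norm_ge0 ?addr_ge0.
rewrite add_lfunE opp_lfunE !hyperproj_delta opprB addrC addrA subrK.
rewrite -scalerBr l1normZ.
apply: (@le_trans _ _ (normc (f 0 j) * (norm1 (x - x') + norm1 (t - t')))).
  rewrite ler_wpM2l ?normc_ge0// -big_split/=; apply: ler_sum => k _.
  rewrite !mxE -mulrBr normcM normc_phase mul1r distrC [`|t 0 k - _|]distrC.
  exact: normc_complex_le.
rewrite ler_wpM2r ?addr_ge0// /l1norm (bigD1 j)//= lerDl sumr_ge0// => k _.
exact: normc_ge0.
Qed.

End HyperplaneProjections.
End ComplexColumns.

(** * Minimal competitors and the quadratic estimate *)

Lemma minimal_projection_le (R : realType) (n : nat)
    (Y : {vspace 'rV[R[i]]_n}) (P Q : 'End('rV[R[i]]_n)) :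
  (0 < n)%N -> minimal_projection (@l1norm R n) Y P -> is_projection Y Q ->
  opnorm (@l1norm R n) Q <= opnorm (@l1norm R n) P ->
  minimal_projection (@l1norm R n) Y Q.
Proof.
move=> n0 [_ Pmin] Qproj QP; split=> //; apply/eqP.
rewrite eq_le -{1}Pmin QP; apply: ge_inf; last by exists Q.
by exists 0 => _ [S _ <-]; exact: opnorm_l1_ge0.
Qed.

Theorem theorem5p7 (R : realType) (n : nat) (hn : (2 <= n)%N)
    (f : 'rV[R[i]]_n) (hf : f != 0) (Y : {vspace 'rV[R[i]]_n})
    (hY : forall z : 'rV[R[i]]_n,
        (z \in Y) = (\sum_(j < n) f 0 j * z 0 j == 0))
    (P : 'End('rV[R[i]]_n)) :
  unique_minimal_projection (@l1norm R n) Y P ->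
  strongly_unique_minimal_projection (@l1norm R n) 2 Y P.
Proof.
move=> [Pmin Puniq]; have Pproj := Pmin.1; split=> //.
have n0 : (0 < n)%N by exact: ltnW.
set w := modulus f; set M := opnorm (@l1norm R n) P.
have [y fy PE] := projection_hyperproj _ _ _ hf hY Pproj.
have [x0 [t0 yE]] := twist_surj f y.
move: fy PE; rewrite {y}yE dot_twist => -[wx0 wt0] PE.
have x0M j : colnorm w x0 j <= M.
  apply: le_trans (opnorm_l1_ge _ j); rewrite PE l1norm_hyperproj_twist.
  exact: ccolnorm_ge.
(* The projection built from [twist f x 0] has norm at most [M], so it is minimal and equals [P];
   injectivity then compares real and imaginary parts. *)
have real_eq (x : 'rV[R]_n) : \sum_k w 0 k * x 0 k = 1 ->
    (forall j, colnorm w x j <= M) -> x = x0 /\ 0 = t0.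
  move=> wx xM; apply: (twist_inj f); apply: (hyperproj_inj _ hf).
  rewrite -PE; apply: Puniq; apply: (minimal_projection_le _ _ _ _ _ n0 Pmin).
    apply: hyperproj_projection hY _; rewrite dot_twist wx.
    by rewrite big1 // => k _; rewrite !mxE mulr0.
  apply: opnorm_l1_le => [|j]; first exact: opnorm_l1_ge0.
  by rewrite l1norm_hyperproj_twist ccolnorm_real.
have t00 : t0 = 0 by have [] := real_eq x0 wx0 x0M.
have [r r0 sharp] := colnorm_sharp _ _ _ _ _ hn wx0 x0M
  (fun x wx xM => (real_eq x wx xM).1).
(* One rate for both kinds of growth: [r] for real directions, the nonzero weights for imaginary
   ones. *)
pose m := \big[Num.min/r]_(j | w 0 j != 0) w 0 j.
have w_ge0 j : 0 <= w 0 j by rewrite mxE normc_ge0.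
have m0 : 0 < m.
  by apply: lt_bigmin => // j wj; rewrite lt_neqAle eq_sym wj w_ge0.
have mr : m <= r by exact: bigmin_le_id.
have mw j : w 0 j != 0 -> m <= w 0 j by move=> wj; exact: bigmin_le_cond.
set F := l1norm f.
have F0 : 0 < F.
  move/rV0Pn: hf => [j fj]; rewrite /F /l1norm (bigD1 j)//=.
  rewrite ltr_wpDr ?sumr_ge0// => [k _|]; first exact: normc_ge0.
  rewrite lt_neqAle normc_ge0 andbT eq_sym; apply: contra_neq fj.
  exact: ComplexField.Normc.eq0_normc.
(* [F] converts [d + e] into an operator norm bound; the 2 comes from (d + e)^2 <= 2 (d^2 + e^2). *)
exists (m ^+ 2 / (2 * F ^+ 2)); first by rewrite divr_gt0 ?mulr_gt0 ?exprn_gt0.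
move=> Q Qproj.
rewrite !(powR_mulrn 2) ?opnorm_l1_ge0//.
have [y fy QE] := projection_hyperproj _ _ _ hf hY Qproj.
have [x [t yE]] := twist_surj f y.
move: fy QE; rewrite {y}yE dot_twist => -[wx wt] QE.
have [j wj sharpj] := sharp x wx.
have := opnorm_hyperprojB f x t x0 t0; rewrite -PE -QE t00 subr0 -/F.
have := opnorm_l1_ge0 (Q - P) n0; set D := opnorm _ (Q - P) => D0.
have d0 : 0 <= norm1 (x - x0) by exact: sumr_ge0.
have e0 : 0 <= norm1 t by exact: sumr_ge0.
have M0 : 0 <= M by exact: opnorm_l1_ge0.
have Qj : ccolnorm f x t j <= opnorm (@l1norm R n) Q.
  by rewrite -l1norm_hyperproj_twist -QE; exact: opnorm_l1_ge.
have col0 : 0 <= colnorm w x j by exact: sumr_ge0.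
have {}Qj : ccolnorm f x t j ^+ 2 <= opnorm (@l1norm R n) Q ^+ 2.
  rewrite ler_sqr ?nnegrE ?opnorm_l1_ge0//.
  exact: le_trans col0 (ccolnorm_ge _ _ _ _).
have Qj2 := le_trans (ccolnorm_sqr f x t j) Qj.
move: (mw j wj) Qj2 sharpj; rewrite -/w; move: d0 e0.
set d := norm1 (x - x0); set e := norm1 t.
move: col0 (w_ge0 j); set c := colnorm w x j; set a := w 0 j.
set q := opnorm _ Q => c0 a0 d0 e0 ma Qj2 sharpj DF.
have h1 : (M + m * d) ^+ 2 <= c ^+ 2.
  rewrite ler_sqr ?nnegrE ?addr_ge0 ?mulr_ge0 ?(ltW m0)//.
  by apply: le_trans sharpj; rewrite lerD2l ler_wpM2r.
have h2 : (m * e) ^+ 2 <= (a * e) ^+ 2.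
  by rewrite ler_sqr ?nnegrE ?mulr_ge0 ?(ltW m0)// ler_wpM2r.
have h3 : D ^+ 2 <= F ^+ 2 * (d + e) ^+ 2.
  by rewrite -exprMn ler_sqr ?nnegrE ?mulr_ge0 ?addr_ge0 ?(ltW F0).
have h4 : m ^+ 2 / (2 * F ^+ 2) * D ^+ 2 <= m ^+ 2 / 2 * (d + e) ^+ 2.
  have -> : m ^+ 2 / 2 * (d + e) ^+ 2 =
      m ^+ 2 / (2 * F ^+ 2) * (F ^+ 2 * (d + e) ^+ 2).
    by field; rewrite gt_eqF.
  by rewrite ler_wpM2l// divr_ge0 ?sqr_ge0// mulr_ge0 ?sqr_ge0.
(* [h5] discards the cross term of [(M + m * d) ^+ 2], and [h6] bounds m^2 (d + e)^2 / 2 by m^2 (d^2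
   + e^2). *)
have h5 : 0 <= M * (m * d) by rewrite !mulr_ge0 ?(ltW m0).
have h6 : 0 <= m ^+ 2 * (d - e) ^+ 2 by rewrite mulr_ge0 ?sqr_ge0.
lra.
Qed.
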